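(* For every integer $n\ge1$, let $g_n:[1,2n+1]\to[1,2n+1]$ be the continuous map with $g_n(1)=n+1$, $g_n(j)=2n+3-j$ for every integer $2\le j\le n+1$, $g_n(j)=2n+2-j$ for every integer $n+2\le j\le 2n+1$, and $g_n$ linear on $[j,j+1]$ for every integer $1\le j\le 2n$ (so in particular $g_n(2)=2n+1$, $g_n(n+1)=n+2$, $g_n(n+2)=n$, $g_n(2n+1)=1$). Define the sequence $(b_{n,k})_{k\ge1}$ by: $b_{n,2k-1}=1$ for $1\le k\le n$; $b_{n,2k-1}=2^{k-n-1}(2k-1)+1$ for $n+1\le k\le 2n$; $b_{n,2k}=2^{k+1}-1$ for $1\le k\le 2n$; and $b_{n,k}=3b_{n,k-2}-\sum_{i=2}^{2n}b_{n,k-2i}$ for $k\ge 4n+1$. Then for all integers $k\ge1$ and $n\ge1$, $b_{n,k}$ is the number of distinct fixed points of $g_n^k$ in $[1,2n+1]$. Consequently, setting $\phi_{b_n}(k)=b_{n,k}$, we have $\Phi_1(k,\phi_{b_n})\equiv0\pmod k$ for all integers $k\ge1$. Moreover, the generating function $G_{b_n}(z)=\sum_{k\ge1}b_{n,k}z^k$ equals $$G_{b_n}(z)=\frac{z+\sum_{k=2}^{2n}(-1)^kkz^k}{1-z-\sum_{k=2}^{2n}(-1)^kz^k}.$$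
   Context: $g_n^k$ denotes the $k$-th iterate of $g_n$. For an integer-valued function $\phi$ on the positive integers: $\Phi_1(1,\phi)=\phi(1)$, and if $m=p_1^{k_1}\cdots p_r^{k_r}$ with $p_1,\dots,p_r$ distinct primes and $r,k_i\ge1$, then $\Phi_1(m,\phi)=\sum_{T\subseteq\{1,\dots,r\}}(-1)^{|T|}\phi\big(m/\prod_{i\in T}p_i\big)$ (empty product $=1$). *)

(* Defs.v *)
From HB Require Import structures.
From mathcomp Require Import all_boot all_order all_algebra finmap.
From mathcomp Require Import zify ring lra.
From mathcomp Require Import all_classical reals topology normedtype.
Set Implicit Arguments.
Unset Strict Implicit.
Unset Printing Implicit Defensive.
Import Order.TTheory GRing.Theory Num.Theory.
Import numFieldNormedType.Exports.
Local Open Scope classical_set_scope.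
Local Open Scope ring_scope.

Definition dom {R : realType} (n : nat) : set R := `[1, (2 * n + 1)%:R].

Definition linear_on {R : realType} (a b : R) (f : R -> R) : Prop :=
  exists s c : R, forall x, a <= x <= b -> f x = s * x + c.

(* A map of [1, 2n+1] into itself is a total function on R of which only the
   values on [1, 2n+1] are constrained; on that interval [is_g] determines it. *)
Record is_g {R : realType} (n : nat) (g : R -> R) : Prop := IsG {
  g_stable : forall x, dom n x -> dom n (g x);
  g_continuous : {within dom n, continuous g};
  g_at1 : g 1 = (n + 1)%:R;
  g_low : forall j : nat, (2 <= j <= n + 1)%N -> g j%:R = (2 * n + 3 - j)%:R;
  g_high : forall j : nat,
    (n + 2 <= j <= 2 * n + 1)%N -> g j%:R = (2 * n + 2 - j)%:R;
  g_linear : forall j : nat,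
    (1 <= j <= 2 * n)%N -> linear_on j%:R (j + 1)%:R g
}.

(* The value [b 0] is unconstrained. No subtraction on indices or exponents
   truncates in the given ranges; those on values are in [int]. *)
Record is_b (n : nat) (b : nat -> int) : Prop := IsB {
  b_odd1 : forall k : nat, (1 <= k <= n)%N -> b (2 * k - 1)%N = 1;
  b_odd2 : forall k : nat, (n + 1 <= k <= 2 * n)%N ->
    b (2 * k - 1)%N = 2 ^+ (k - n - 1) * (2 * k%:Z - 1) + 1;
  b_even : forall k : nat, (1 <= k <= 2 * n)%N ->
    b (2 * k)%N = 2 ^+ (k + 1) - 1;
  b_rec : forall k : nat, (4 * n + 1 <= k)%N ->
    b k = 3 * b (k - 2)%N - \sum_(2 <= i < (2 * n).+1) b (k - 2 * i)%N
}.

Definition fixed_points {R : realType} (n k : nat) (g : R -> R) : set R :=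
  [set x | dom n x /\ iter k g x = x].

(* [primes m] lists the distinct primes dividing [m]; it is empty for [m = 1],
   where the sum reduces to its term [T = set0], that is [phi 1]. *)
Definition Phi1 (m : nat) (phi : nat -> int) : int :=
  \sum_(T : {set 'I_(size (primes m))})
    (-1) ^+ #|T| * phi (m %/ \prod_(i in T) nth 1%N (primes m) i)%N.

(* Formal power series over Z are given by their coefficients. *)
Definition fps := nat -> int.

Definition fps_mul (u v : fps) : fps :=
  fun k => \sum_(i < k.+1) u i * v (k - i)%N.

Definition fps_poly (p : {poly int}) : fps := fun k => p`_k.

(* [u = v / w] in the ring Z[[z]]: [w] is invertible and [u = v * w^-1]. *)
Definition fps_is_quotient (u v w : fps) : Prop :=
  exists2 w' : fps, fps_mul w w' =1 fps_poly 1 & u =1 fps_mul v w'.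

Definition gen_fun (b : nat -> int) : fps :=
  fun k => if k is 0%N then 0 else b k.

Definition gf_num (n : nat) : {poly int} :=
  'X + \sum_(2 <= k < (2 * n).+1) ((-1) ^+ k * k%:Z) *: 'X^k.

Definition gf_den (n : nat) : {poly int} :=
  1 - 'X - \sum_(2 <= k < (2 * n).+1) (-1) ^+ k *: 'X^k.

(* The two specifications are consistent and determine their objects. *)

Definition g_fun {R : realType} (n : nat) (x : R) : R :=
  Num.min (n%:R * x + 1)
    (Num.min (2 * n%:R + 3 - x)
       (Num.max (2 * n%:R + 2 - x) (3 * n%:R + 4 - 2 * x))).

Lemma g_fun1 {R : realType} n (x : R) : (1 <= n)%N -> 1 <= x <= 2 ->
  g_fun n x = n%:R * x + 1.
Proof.
move=> n1 /andP[x1 x2]; have n1' : 1 <= n%:R :> R by rewrite ler1n.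
rewrite /g_fun; apply/min_idPl.
rewrite le_min le_max; apply/andP; split; first nra.
apply/orP; right; nra.
Qed.

Lemma g_fun2 {R : realType} n (x : R) : (1 <= n)%N -> 2 <= x <= n%:R + 1 ->
  g_fun n x = 2 * n%:R + 3 - x.
Proof.
move=> n1 /andP[x1 x2]; have n1' : 1 <= n%:R :> R by rewrite ler1n.
have e : Num.min (2 * n%:R + 3 - x)
   (Num.max (2 * n%:R + 2 - x) (3 * n%:R + 4 - 2 * x)) = 2 * n%:R + 3 - x.
  by apply/min_idPl; rewrite le_max; apply/orP; right; lra.
rewrite /g_fun e; apply/min_idPr; nra.
Qed.

Lemma g_fun3 {R : realType} n (x : R) : (1 <= n)%N ->
  n%:R + 1 <= x <= n%:R + 2 -> g_fun n x = 3 * n%:R + 4 - 2 * x.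
Proof.
move=> n1 /andP[x1 x2]; have n1' : 1 <= n%:R :> R by rewrite ler1n.
have e : Num.max (2 * n%:R + 2 - x) (3 * n%:R + 4 - 2 * x)
         = 3 * n%:R + 4 - 2 * x by apply/max_idPr; lra.
have e' : Num.min (2 * n%:R + 3 - x) (3 * n%:R + 4 - 2 * x)
         = 3 * n%:R + 4 - 2 * x by apply/min_idPr; lra.
rewrite /g_fun e e'; apply/min_idPr; nra.
Qed.

Lemma g_fun4 {R : realType} n (x : R) : (1 <= n)%N ->
  n%:R + 2 <= x -> g_fun n x = 2 * n%:R + 2 - x.
Proof.
move=> n1 x1; have n1' : 1 <= n%:R :> R by rewrite ler1n.
have e : Num.max (2 * n%:R + 2 - x) (3 * n%:R + 4 - 2 * x)
         = 2 * n%:R + 2 - x by apply/max_idPl; lra.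
have e' : Num.min (2 * n%:R + 3 - x) (2 * n%:R + 2 - x)
         = 2 * n%:R + 2 - x by apply/min_idPr; lra.
rewrite /g_fun e e'; apply/min_idPr; nra.
Qed.

Lemma is_g_exists {R : realType} n : (1 <= n)%N -> is_g n (@g_fun R n).
Proof.
move=> n1; have n1' : 1 <= n%:R :> R by rewrite ler1n.
split.
- move=> x; rewrite /dom /= !in_itv /= natrD natrM => /andP[x1 x2].
  have [h|h] := leP x 2.
    by rewrite g_fun1 ?x1 ?h //; apply/andP; split; nra.
  have [h'|h'] := leP x (n%:R + 1).
    by rewrite g_fun2 ?h' ?(ltW h) //; apply/andP; split; lra.
  have [h''|h''] := leP x (n%:R + 2).
    by rewrite g_fun3 ?h'' ?(ltW h') //; apply/andP; split; lra.
  by rewrite g_fun4 ?(ltW h'') //; apply/andP; split; lra.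
- apply: continuous_subspaceT => x.
  have c (s a : R) : {for x, continuous (fun y : R => a - s * y)}.
    apply: cvgB; first exact: cvg_cst.
    by apply: cvgM; [exact: cvg_cst|exact: cvg_id].
  have -> : @g_fun R n = fun y => Num.min (1 - (- n%:R) * y)
    (Num.min (2 * n%:R + 3 - 1 * y)
       (Num.max (2 * n%:R + 2 - 1 * y) (3 * n%:R + 4 - 2 * y))).
    apply/funext => y; rewrite /g_fun mul1r; congr Num.min; ring.
  exact: (continuous_min (@c _ _)
    (continuous_min (@c _ _) (continuous_max (@c _ _) (@c _ _)))).
- by rewrite g_fun1 ?natrD ?mulr1 //; apply/andP; split; lra.
- move=> j /andP[j1 j2].
  have j1' : 2 <= j%:R :> R by rewrite ler_nat.
  have j2' : j%:R <= n%:R + 1 :> R by rewrite natr1 ler_nat; lia.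
  rewrite g_fun2 ?j1' // natrB; last by lia.
  by rewrite natrD natrM.
- move=> j /andP[j1 j2].
  have j1' : n%:R + 2 <= j%:R :> R by rewrite -natrD ler_nat.
  rewrite g_fun4 // natrB; last by lia.
  by rewrite natrD natrM.
- move=> j /andP[j1 j2]; rewrite /linear_on natrD.
  have j1' : 1 <= j%:R :> R by rewrite ler1n.
  have [e|ne1] := eqVneq j 1%N.
    exists n%:R, 1 => x /andP[x1 x2]; rewrite g_fun1 //.
    by move: x1 x2; rewrite e => x1 x2; apply/andP; split; lra.
  have [jn|jn] := leqP j n.
    exists (-1), (2 * n%:R + 3) => x /andP[x1 x2]; rewrite g_fun2 //; first ring.
    have : 2 <= j%:R :> R by rewrite ler_nat; lia.
    have : j%:R <= n%:R :> R by rewrite ler_nat.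
    by move=> ? ?; apply/andP; split; lra.
  have [e|ne2] := eqVneq j n.+1.
    exists (-2), (3 * n%:R + 4) => x /andP[x1 x2]; rewrite g_fun3 //; first ring.
    by move: x1 x2; rewrite e -natr1 => x1 x2; apply/andP; split; lra.
  exists (-1), (2 * n%:R + 2) => x /andP[x1 x2]; rewrite g_fun4 //; first ring.
  have : n%:R + 2 <= j%:R :> R by rewrite -natrD ler_nat; lia.
  by move=> ?; lra.
Qed.

Lemma is_g_unique {R : realType} n (g h : R -> R) : (1 <= n)%N ->
  is_g n g -> is_g n h -> {in dom n, g =1 h}.
Proof.
move=> n1 Hg Hh x; rewrite inE /dom /= in_itv /= => /andP[x1 x2].
have E (j : nat) : (1 <= j <= 2 * n + 1)%N -> g j%:R = h j%:R.
  move=> /andP[j1 j2]; have [->|ne] := eqVneq j 1%N.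
    by rewrite (g_at1 Hg) (g_at1 Hh).
  have [jn|jn] := leqP j (n + 1).
    have H : (2 <= j <= n + 1)%N by lia.
    by rewrite (g_low Hg H) (g_low Hh H).
  have H : (n + 2 <= j <= 2 * n + 1)%N by lia.
  by rewrite (g_high Hg H) (g_high Hh H).
have [j j12 xj] : exists2 j : nat, (1 <= j <= 2 * n)%N &
    j%:R <= x <= (j + 1)%:R.
  have : forall m : nat, (1 <= m)%N -> x <= (m + 1)%:R ->
      exists2 j : nat, (1 <= j <= m)%N & j%:R <= x <= (j + 1)%:R.
    elim=> // m IH _ xm.
    have [h1|h1] := leP (m.+1)%:R x.
      by exists m.+1; rewrite ?leqnn ?h1.
    have [m0|m0] := eqVneq m 0%N.
      by exfalso; move: h1; rewrite m0 ltNge x1.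
    have [||j jm jx] := IH; first by lia.
      by rewrite addn1 ltW.
    by exists j => //; lia.
  by apply=> //; lia.
have [s [c Hs]] := g_linear Hg j12.
have [s' [c' Hs']] := g_linear Hh j12.
have l : j%:R <= (j%:R : R) <= (j + 1)%:R by rewrite natrD; lra.
have r : j%:R <= ((j + 1)%:R : R) <= (j + 1)%:R by rewrite natrD; lra.
have H1 : (1 <= j <= 2 * n + 1)%N by lia.
have H2 : (1 <= j + 1 <= 2 * n + 1)%N by lia.
move: (E _ H1) (E _ H2); rewrite Hs // Hs' // Hs // Hs' // natrD => e1 e2.
have es : s = s' by lra.
by rewrite Hs // Hs' // es; move: e1; rewrite es => /addrI ->.
Qed.

Definition b_init (n k : nat) : int :=
  if odd k then
    if (k.+1./2 <= n)%N then 1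
    else 2 ^+ (k.+1./2 - n - 1) * (2 * (k.+1./2)%:Z - 1) + 1
  else 2 ^+ (k./2 + 1) - 1.

Fixpoint b_fuel (n m k : nat) : int :=
  if m is m'.+1 then
    if (k <= 4 * n)%N then b_init n k
    else 3 * b_fuel n m' (k - 2)%N
         - \sum_(2 <= i < (2 * n).+1) b_fuel n m' (k - 2 * i)%N
  else b_init n k.

Definition b_fun (n k : nat) : int := b_fuel n k k.

Lemma b_fuelE n m k : (k <= m)%N -> b_fuel n m k = b_fun n k.
Proof.
rewrite /b_fun; elim/ltn_ind: k m => k IH [|m]; first by case: k IH.
case: k IH => [|k] IH km; first by [].
rewrite /=; case: ifP => // h.
rewrite (IH (k.+1 - 2)%N) ?(IH (k.+1 - 2)%N _ k); try lia.
congr (_ - _); apply: eq_big_nat => i /andP[i1 i2].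
by rewrite (IH (k.+1 - 2 * i)%N) ?(IH (k.+1 - 2 * i)%N _ k) //; lia.
Qed.

Lemma b_funE n k : (k <= 4 * n)%N -> b_fun n k = b_init n k.
Proof. by rewrite /b_fun; case: k => //= k ->. Qed.

Lemma is_b_exists n : is_b n (b_fun n).
Proof.
split=> [k /andP[k1 k2]|k /andP[k1 k2]|k /andP[k1 k2]|k h].
- rewrite b_funE ?/b_init; last by lia.
  have -> : (2 * k - 1 = (k.-1).*2.+1)%N by lia.
  rewrite /= odd_double /=; case: ifP => //; lia.
- rewrite b_funE ?/b_init; last by lia.
  have -> : (2 * k - 1 = (k.-1).*2.+1)%N by lia.
  rewrite /= odd_double /= doubleK prednK; last by lia.
  by case: ifP => //; lia.
- rewrite b_funE ?/b_init; last by lia.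
  by rewrite mul2n odd_double doubleK.
- case: k h => [|k] h; first by lia.
  rewrite {1}/b_fun /= ifF; last by lia.
  rewrite b_fuelE; last by lia.
  congr (_ - _); apply: eq_big_nat => i /andP[i1 i2].
  by rewrite b_fuelE //; lia.
Qed.

Lemma is_b_unique n (b c : nat -> int) : (1 <= n)%N ->
  is_b n b -> is_b n c -> forall k, (1 <= k)%N -> b k = c k.
Proof.
move=> n1 Hb Hc; elim/ltn_ind => k IH k1.
have [h|h] := leqP k (4 * n); last first.
  have h' : (4 * n + 1 <= k)%N by lia.
  rewrite (b_rec Hb h') (b_rec Hc h') IH; try lia.
  congr (_ - _); apply: eq_big_nat => i /andP[i1 i2]; apply: IH; lia.
case ok: (odd k).
  have -> : (k = 2 * k.+1./2 - 1)%N by lia.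
  have [H|H] : (1 <= k.+1./2 <= n)%N \/ (n + 1 <= k.+1./2 <= 2 * n)%N by lia.
    by rewrite (b_odd1 Hb H) (b_odd1 Hc H).
  by rewrite (b_odd2 Hb H) (b_odd2 Hc H).
have -> : (k = 2 * k./2)%N by lia.
have H : (1 <= k./2 <= 2 * n)%N by lia.
by rewrite (b_even Hb H) (b_even Hc H).
Qed.

(* Main.v *)
Require Import Defs.
From mathcomp Require Import all_boot all_order all_algebra finmap.
From mathcomp Require Import all_classical reals topology normedtype.
From mathcomp Require Import zify ring lra.
Set Implicit Arguments.
Unset Strict Implicit.
Unset Printing Implicit Defensive.
Import Order.TTheory GRing.Theory Num.Theory.
Local Open Scope classical_set_scope.
Local Open Scope ring_scope.

(* The intervals [j, j+1] form a Markov partition for g_n.  Ordered along the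
   orbit of the interval [n+1, n+2], they are laps 0, ..., 2n-1 with transitions
   i -> i+1, 0 -> 0 and 2n-1 -> every even lap.  Every closed walk of length k
   is followed by exactly one fixed point of g_n^k, because composing inverse
   branches along it gives an affine self-map of [0, 1] of slope different
   from 1.  Distinct closed walks give distinct points, because each integer is
   assigned to the one adjacent lap whose one-sided germ at that integer is
   periodic.  So the number of fixed points is the trace of the k-th power of
   the transition matrix, which is the coefficient of z^k in -z d'(z) / d(z)
   with d the denominator of G_{b_n}.  As (1+z) d(z) = 1 - 2 z^2 - z^(2n+1),
   and d(z) d(-z) = 1 - 3 z^2 + z^4 + ... + z^(4n), these coefficients satisfy
   the defining relations of b_n.  Finally Phi_1(k) counts, by inclusion and
   exclusion, the points of exact period k, which fall into orbits of size k. *)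

(** * Formal power series and the recurrence *)

Definition fps_add (u v : fps) : fps := fun k => u k + v k.

Definition fps_trunc (K : nat) (u : fps) : {poly int} := \poly_(i < K) u i.

(** Coefficient [k] involves only the terms of index at most [k], so commutativity and associativity
    are inherited from [{poly int}]. *)
Lemma fps_mulE K (u v : fps) k : (k < K)%N ->
  fps_mul u v k = (fps_trunc K u * fps_trunc K v)`_k.
Proof.
move=> kK; rewrite coefM; apply: eq_bigr => i _.
by rewrite !coef_poly !ifT //; have := ltn_ord i; lia.
Qed.

Lemma fps_mulC (u v : fps) : fps_mul u v =1 fps_mul v u.
Proof. by move=> k; rewrite !(@fps_mulE k.+1) // mulrC. Qed.

Lemma fps_mulA (u v w : fps) :
  fps_mul u (fps_mul v w) =1 fps_mul (fps_mul u v) w.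
Proof.
move=> k; pose t := fps_trunc k.+1.
have -> : fps_mul u (fps_mul v w) k = (t u * (t v * t w))`_k.
  rewrite coefM; apply: eq_bigr => i _.
  by rewrite coef_poly ltn_ord (@fps_mulE k.+1) // ltnS leq_subr.
rewrite mulrA coefM; apply: eq_bigr => i _.
by rewrite (@fps_mulE k.+1) // coef_poly ltnS leq_subr.
Qed.

Lemma eq_fps_mul (u u' v v' : fps) :
  u =1 u' -> v =1 v' -> fps_mul u v =1 fps_mul u' v'.
Proof. by move=> eu ev k; apply: eq_bigr => i _; rewrite eu ev. Qed.

Lemma fps_mul_poly (p q : {poly int}) :
  fps_mul (fps_poly p) (fps_poly q) =1 fps_poly (p * q).
Proof. by move=> k; rewrite /fps_poly coefM. Qed.

Lemma fps_mulDr (u v w : fps) :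
  fps_mul u (fps_add v w) =1 fps_add (fps_mul u v) (fps_mul u w).
Proof.
by move=> k; rewrite /fps_add /fps_mul -big_split; apply: eq_bigr => i _; rewrite mulrDr.
Qed.

Lemma fps_mulXn m (u : fps) k :
  fps_mul (fps_poly 'X^m) u k = if (m <= k)%N then u (k - m)%N else 0.
Proof.
rewrite /fps_mul /fps_poly; case: leqP => mk.
  rewrite (bigD1 (Ordinal (mk : (m < k.+1)%N))) //= coefXn eqxx mul1r big1 ?addr0 //.
  by move=> i ne; rewrite coefXn -val_eqE in ne *; rewrite (negbTE ne) mul0r.
apply: big1 => i _; rewrite coefXn.
by case: eqP => [e|_]; [have := ltn_ord i; lia | rewrite mul0r].
Qed.

Lemma fps_mul1 (u : fps) : fps_mul (fps_poly 1) u =1 u.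
Proof. by move=> k; rewrite -(expr0 'X) fps_mulXn subn0. Qed.

Lemma fps_mul_polyD (p q : {poly int}) (u : fps) k :
  fps_mul (fps_poly (p + q)) u k = fps_mul (fps_poly p) u k + fps_mul (fps_poly q) u k.
Proof.
by rewrite /fps_mul -big_split; apply: eq_bigr => i _; rewrite /fps_poly coefD mulrDl.
Qed.

Lemma fps_mul_polyZ c (p : {poly int}) (u : fps) k :
  fps_mul (fps_poly (c *: p)) u k = c * fps_mul (fps_poly p) u k.
Proof.
by rewrite /fps_mul mulr_sumr; apply: eq_bigr => i _; rewrite /fps_poly coefZ mulrA.
Qed.

Lemma fps_mul_poly_sum (r : seq nat) (F : nat -> {poly int}) (u : fps) k :
  fps_mul (fps_poly (\sum_(i <- r) F i)) u k
  = \sum_(i <- r) fps_mul (fps_poly (F i)) u k.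
Proof.
rewrite /fps_mul exchange_big; apply: eq_bigr => i _.
by rewrite /fps_poly coef_sum mulr_suml.
Qed.

(** * Polynomial identities for the numerator and the denominator *)

Lemma coef_gf_den n l : (1 <= n)%N -> (gf_den n)`_l =
  if l == 0%N then 1 else if l == 1%N then -1 else
  if (l <= 2 * n)%N then - (-1) ^+ l else 0.
Proof.
move=> n1; rewrite /gf_den !coefB coef1 coefX coef_sum.
have [l2|l2] := ltnP l 2.
  rewrite big_nat big1; first by case: l l2 => [|[|]].
  by move=> i /andP[i2 _]; rewrite coefZ coefXn; case: eqP => [?|]; [lia|rewrite mulr0].
have -> : (l == 0%N) = false by lia.
have -> : (l == 1%N) = false by lia.
rewrite subr0 sub0r; case: leqP => ln.
  rewrite (bigD1_seq l) ?iota_uniq ?mem_index_iota ?l2 //= coefZ coefXn eqxx mulr1.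
  rewrite big1 ?addr0 // => i ne; rewrite coefZ coefXn eq_sym (negbTE ne) mulr0 //.
rewrite big_nat big1 ?oppr0 // => i /andP[_ i2].
by rewrite coefZ coefXn; case: eqP => [?|]; [lia|rewrite mulr0].
Qed.

Lemma coef_gf_num n l : (1 <= n)%N -> (gf_num n)`_l =
  if l == 1%N then 1 else if (l <= 2 * n)%N then (-1) ^+ l * l%:Z else 0.
Proof.
move=> n1; rewrite /gf_num coefD coefX coef_sum.
have [l2|l2] := ltnP l 2.
  rewrite big_nat big1; first by case: l l2 => [|[|]].
  by move=> i /andP[i2 _]; rewrite coefZ coefXn; case: eqP => [?|]; [lia|rewrite mulr0].
have -> : (l == 1%N) = false by lia.
rewrite add0r; case: leqP => ln.
  rewrite (bigD1_seq l) ?iota_uniq ?mem_index_iota ?l2 //= coefZ coefXn eqxx mulr1.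
  rewrite big1 ?addr0 // => i ne; rewrite coefZ coefXn eq_sym (negbTE ne) mulr0 //.
rewrite big_nat big1 ?oppr0 // => i /andP[_ i2].
by rewrite coefZ coefXn; case: eqP => [?|]; [lia|rewrite mulr0].
Qed.

(** The product telescopes because consecutive terms have opposite signs; this is why the factor
    [1 + 'X] makes the denominator sparse. *)
Lemma mul1X_alternating_sum m :
  (1 + 'X) * (\sum_(2 <= k < m.+2) (-1) ^+ k *: 'X^k)
  = 'X^2 - (-1) ^+ m *: 'X^(m.+2) :> {poly int}.
Proof.
elim: m => [|m IH]; first by rewrite big_geq // mulr0 expr0 scale1r subrr.
rewrite big_nat_recr //= mulrDr IH -!mul_polyC !rmorphXn /= !rmorphN1 !exprS.
ring.
Qed.

Lemma mul1X_gf_den n : (1 <= n)%N ->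
  (1 + 'X) * gf_den n = 1 - 2 *: 'X^2 - 'X^((2 * n).+1).
Proof.
move=> n1; have [m ->] : exists m, (n = m.+1)%N by exists n.-1; lia.
have -> : gf_den m.+1 = 1 - 'X - \sum_(2 <= k < (2 * m).+1.+2) (-1) ^+ k *: 'X^k.
  by rewrite /gf_den; congr (_ - \sum_(2 <= k < _) _); lia.
have -> : (2 * m.+1).+1 = (2 * m).+3 by lia.
have sgn : (-1) ^+ (2 * m).+1 = -1 :> int by rewrite exprS exprM sqrrN !expr1n mulr1.
rewrite mulrBr mul1X_alternating_sum sgn scaleN1r.
rewrite scaler_nat; ring.
Qed.

(** As 1/(1+z) has coefficients (-1)^k, the left side is (1+z) d(z) times the series of b_k +
    (-1)^k. Its sparseness gives that sequence a short recurrence. *)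
Lemma mul1X_gf_num n : (1 <= n)%N ->
  (1 + 'X) * gf_num n + gf_den n = 1 + 2 *: 'X^2 + (2 * n)%:Z *: 'X^((2 * n).+1).
Proof.
move=> n1.
(* The induction passes through upper limits of both parities; [m = 2 n - 1] is the case used. *)
have H m : (1 + 'X) * ('X + \sum_(2 <= k < m.+2) ((-1) ^+ k * k%:Z) *: 'X^k)
    + (1 - 'X - \sum_(2 <= k < m.+2) (-1) ^+ k *: 'X^k)
    = 1 + 2 *: 'X^2 - ((-1) ^+ m * m.+1%:Z) *: 'X^(m.+2) :> {poly int}.
  elim: m => [|m IH].
    by rewrite !big_geq // expr0 mul1r -!mul_polyC; ring.
  rewrite big_nat_recr //= [in X in _ - X]big_nat_recr //=.
  set S := \sum_(2 <= k < _) _ in IH *; set S' := \sum_(2 <= k < _) _ in IH *.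
  transitivity ((1 + 'X) * ('X + S) + (1 - 'X - S') +
    ((1 + 'X) * (((-1) ^+ m.+2 * m.+2%:Z) *: 'X^(m.+2))
     - (-1) ^+ m.+2 *: 'X^(m.+2))); first by ring.
  rewrite IH -[m.+2%:Z]/(2 + m)%:Z -[m.+1%:Z]/(1 + m)%:Z !PoszD.
  rewrite -!mul_polyC !rmorphM /= !rmorphD /= !rmorphXn /= !rmorphN1 !exprS.
  ring.
have [m ->] : exists m, (n = m.+1)%N by exists n.-1; lia.
have := H (2 * m).+1.
rewrite /gf_num /gf_den.
have -> : (2 * m.+1).+1 = (2 * m).+3 by lia.
have -> : (2 * m.+1 = (2 * m).+2)%N by lia.
have sgn : (-1) ^+ (2 * m).+1 = -1 :> int by rewrite exprS exprM sqrrN !expr1n mulr1.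
by move=> ->; rewrite sgn mulN1r scaleNr opprK.
Qed.

(** This is d(-z). *)
Definition gf_den_neg (n : nat) : {poly int} :=
  1 + 'X - \sum_(2 <= k < (2 * n).+1) 'X^k.

Lemma mul1BX_gf_den_neg n : (1 <= n)%N ->
  (1 - 'X) * gf_den_neg n = 1 - 2 *: 'X^2 + 'X^((2 * n).+1).
Proof.
move=> n1.
have H m : (1 - 'X) * (\sum_(2 <= k < m.+2) 'X^k) = 'X^2 - 'X^(m.+2) :> {poly int}.
  elim: m => [|m IH]; first by rewrite big_geq // mulr0 subrr.
  by rewrite big_nat_recr //= mulrDr IH !exprS; ring.
have [m ->] : exists m, (n = m.+1)%N by exists n.-1; lia.
have -> : gf_den_neg m.+1 = 1 + 'X - \sum_(2 <= k < (2 * m).+1.+2) 'X^k.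
  by rewrite /gf_den_neg; congr (_ - \sum_(2 <= k < _) _); lia.
have -> : (2 * m.+1).+1 = (2 * m).+3 by lia.
rewrite mulrBr H scaler_nat; ring.
Qed.

Definition gf_even (n : nat) : {poly int} :=
  1 - 3 *: 'X^2 + \sum_(2 <= i < (2 * n).+1) 'X^(2 * i).

(** Times 1 - z^2, both sides equal (1 - 2 z^2)^2 - z^(4n+2). The product is even in z, hence yields
    a recurrence in steps of 2. *)
Lemma mul_gf_den_gf_den_neg n : (1 <= n)%N ->
  gf_den_neg n * gf_den n = gf_even n.
Proof.
move=> n1.
have nz : (1 - 'X^2 : {poly int}) != 0.
  by apply/eqP => /(congr1 (fun p : {poly int} => p`_0));
    rewrite coefB coef1 coefXn coef0.
apply: (mulfI nz).
have -> : (1 - 'X^2) * (gf_den_neg n * gf_den n)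
    = ((1 - 'X) * gf_den_neg n) * ((1 + 'X) * gf_den n) :> {poly int} by ring.
rewrite mul1X_gf_den // mul1BX_gf_den_neg //.
have H m : (1 - 'X^2) * (\sum_(2 <= i < m.+2) 'X^(2 * i))
    = 'X^2 ^+ 2 - 'X^2 ^+ m.+2 :> {poly int}.
  elim: m => [|m IH]; first by rewrite big_geq // mulr0 subrr.
  by rewrite big_nat_recr //= mulrDr IH exprM !exprS; ring.
have [m e] : exists m, (n = m.+1)%N by exists n.-1; lia.
have e2 : (2 * n).+1 = (2 * m).+3 by lia.
rewrite /gf_even [in RHS]mulrDr e2 H -!exprM !scaler_nat.
have -> : 'X^(2 * (2 * m).+3) = ('X^((2 * m).+3)) ^+ 2 :> {poly int}.
  by rewrite -exprM mulnC.
ring.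
Qed.

Lemma size_gf_num n : (1 <= n)%N -> (size (gf_num n) <= (2 * n).+1)%N.
Proof.
move=> n1; apply/leq_sizeP => j jn; rewrite coef_gf_num //.
by rewrite !ifF //; lia.
Qed.

Lemma size_gf_den_neg n : (1 <= n)%N -> (size (gf_den_neg n) <= (2 * n).+1)%N.
Proof.
move=> n1; apply/leq_sizeP => j jn.
rewrite /gf_den_neg coefB coefD coef1 coefX coef_sum.
have -> : (j == 0%N) = false by lia.
have -> : (j == 1%N) = false by lia.
rewrite big_nat big1 ?subrr // => i /andP[_ i2].
by rewrite coefXn; case: eqP => // ?; lia.
Qed.

(** * The coefficients of the quotient satisfy [is_b] *)

Section QuotientIsB.

Variables (n : nat) (h : fps).
Hypothesis n1 : (1 <= n)%N.
Hypothesis den_h : fps_mul (fps_poly (gf_den n)) h =1 fps_poly 1.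

Let s : fps := fps_mul (fps_poly (gf_num n)) h.

Let den_s : fps_mul (fps_poly (gf_den n)) s =1 fps_poly (gf_num n).
Proof.
move=> k; rewrite /s fps_mulA (eq_fps_mul (fps_mulC _ _) (frefl _)) -fps_mulA.
by rewrite (eq_fps_mul (frefl _) den_h) fps_mulC fps_mul1.
Qed.

(** The product equals [gf_den_neg n * gf_num n], of degree at most 4n. *)
Let even_s k : (4 * n + 1 <= k)%N -> fps_mul (fps_poly (gf_even n)) s k = 0.
Proof.
move=> kn; rewrite -mul_gf_den_gf_den_neg //.
rewrite -(eq_fps_mul (fps_mul_poly _ _) (frefl _)) -fps_mulA.
rewrite (eq_fps_mul (frefl _) den_s) fps_mul_poly /fps_poly nth_default //.
apply: leq_trans (size_polyMleq _ _) _.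
have := size_gf_num n1; have := size_gf_den_neg n1; lia.
Qed.

(** The series 1/(1+z). Adding it to [s] removes the constants 1 and -1 from the closed forms of b,
    and leaves [t] with the recurrence t_k = 2 t_(k-2) + t_(k-2n-1) up to finitely many
    corrections. *)
Let alt : fps := fun k => (-1) ^+ k.
Let t : fps := fps_add s alt.

Let t_rec k : t k = (k == 0%N)%:Z + 2 * (k == 2)%:Z
  + (2 * n)%:Z * (k == (2 * n).+1)%:Z
  + 2 * (if (2 <= k)%N then t (k - 2)%N else 0)
  + (if (2 * n < k)%N then t (k - (2 * n).+1)%N else 0).
Proof.
have alt1 : fps_mul (fps_poly (1 + 'X)) alt =1 fps_poly 1.
  move=> j; rewrite fps_mul_polyD fps_mul1 -['X]expr1 fps_mulXn /fps_poly coef1 /alt.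
  by case: j => [|j] //=; rewrite subn1 /= exprS mulN1r addNr.
have : fps_mul (fps_poly ((1 + 'X) * gf_den n)) t k
    = ((1 + 'X) * gf_num n + gf_den n)`_k.
  rewrite fps_mulDr /fps_add -!(eq_fps_mul (fps_mul_poly _ _) (frefl _)).
  rewrite -fps_mulA (eq_fps_mul (frefl _) den_s) fps_mul_poly /fps_poly coefD.
  congr (_ + _); rewrite (eq_fps_mul (fps_mulC _ _) (frefl _)) -fps_mulA.
  by rewrite (eq_fps_mul (frefl _) alt1) fps_mulC fps_mul1.
rewrite mul1X_gf_den // mul1X_gf_num // -scaleNr -(scaleN1r 'X^_).
rewrite !fps_mul_polyD !fps_mul_polyZ fps_mul1 !fps_mulXn.
rewrite !coefD coef1 !coefZ !coefXn => e.
lra.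
Qed.

Let t_odd_low j : (j < n)%N -> t (2 * j + 1)%N = 0.
Proof.
elim: j => [|j IH] jn; rewrite t_rec [X in _ + X]ifF; try lia.
  rewrite (_ : (_ == (2 * n).+1) = false); last by lia.
  by rewrite muln0 /= !mulr0 !addr0.
rewrite (_ : 2 * j.+1 + 1 - 2 = 2 * j + 1)%N; last by lia.
rewrite IH; last by lia.
rewrite (_ : (_ == 0%N) = false); last by lia.
rewrite (_ : (_ == 2)%N = false); last by lia.
rewrite (_ : (_ == (2 * n).+1) = false); last by lia.
by rewrite if_same !mulr0.
Qed.

Let t_even j : (1 <= j <= 2 * n)%N -> t (2 * j)%N = 2 ^+ (j + 1).
Proof.
elim: j => // j IH jn; rewrite t_rec ifT; last by lia.
rewrite (_ : (_ == (2 * n).+1) = false); last by lia.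
rewrite (_ : 2 * j.+1 - 2 = 2 * j)%N; last by lia.
(* The index lagging by 2n+1 is either negative or odd and below 2n, where [t] vanishes. *)
rewrite [X in _ + X](_ : _ = 0); last first.
  case: ifP => // h1; rewrite (_ : _ - _ = 2 * (j - n) + 1)%N; last by lia.
  by apply: t_odd_low; lia.
case: j IH jn => [|j] IH jn.
  by rewrite muln0 t_rec /= !mulr0 !addr0.
rewrite IH; last by lia.
rewrite (_ : (2 * j.+2 == 2)%N = false); last by lia.
by rewrite [in RHS]addSn exprS; rewrite /= !mulr0 !add0r addr0.
Qed.

Let t_odd_high j : (n <= j < 2 * n)%N ->
  t (2 * j + 1)%N = 2 ^+ (j - n) * (2 * j%:Z + 1).
Proof.
elim: j => [|j IH] jn; first by lia.
rewrite t_rec [X in _ + X]ifT; last by lia.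
rewrite (_ : (_ == 0%N) = false); last by lia.
rewrite (_ : (_ == 2)%N = false); last by lia.
rewrite ifT; last by lia.
rewrite (_ : 2 * j.+1 + 1 - 2 = 2 * j + 1)%N; last by lia.
(* At index 2n+1 the value 2n+1 is the correction 2n plus [t 0 = 1]. *)
have [e|ne] := eqVneq n j.+1.
  rewrite t_odd_low; last by lia.
  rewrite e (_ : (_ == _)%N = true); last by lia.
  rewrite (_ : 2 * j.+1 + 1 - _ = 0)%N; last by lia.
  by rewrite subnn expr0 t_rec /= mulr0; lia.
rewrite (_ : (_ == _)%N = false); last by lia.
rewrite IH; last by lia.
rewrite (_ : 2 * j.+1 + 1 - _ = 2 * (j.+1 - n))%N; last by lia.
rewrite t_even; last by lia.
rewrite (_ : j.+1 - n = (j - n).+1)%N ?addn1 ?exprS; last by lia.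
by rewrite -[j.+1]addn1 PoszD /=; ring.
Qed.

Lemma gf_quotient_is_b : is_b n (fps_mul (fps_poly (gf_num n)) h).
Proof.
have sE k : s k = t k - (-1) ^+ k by rewrite /t /fps_add /alt addrK.
split=> k kn; rewrite -/s.
- rewrite (_ : 2 * k - 1 = 2 * k.-1 + 1)%N; last by lia.
  by rewrite sE t_odd_low; [rewrite exprD exprM sqrrN !expr1n|lia].
- rewrite (_ : 2 * k - 1 = 2 * k.-1 + 1)%N; last by lia.
  rewrite sE t_odd_high; last by lia.
  rewrite exprD exprM sqrrN !expr1n mul1r expr1 opprK.
  by rewrite (_ : k.-1 - n = k - n - 1)%N; last (by lia); congr (_ * _ + _); lia.
- by rewrite sE t_even // exprM sqrrN !expr1n.
- have := even_s kn; rewrite /gf_even -scaleNr !fps_mul_polyD fps_mul_polyZ fps_mul1.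
  rewrite fps_mulXn ifT; last by lia.
  rewrite fps_mul_poly_sum.
  have -> : \sum_(2 <= i < (2 * n).+1) fps_mul (fps_poly 'X^(2 * i)) s k
      = \sum_(2 <= i < (2 * n).+1) s (k - 2 * i)%N.
    by apply: eq_big_nat => i /andP[_ i2]; rewrite fps_mulXn ifT //; lia.
  by move=> E; lra.
Qed.

End QuotientIsB.

(** * Walks in the transition graph *)

(* Vertex [2 m] stands for the interval [n+1+m, n+2+m] and vertex [2 m - 1] for
   [n+1-m, n+2-m]; an edge means that the image of the first interval under
   [g_n] covers the second. *)
Definition edge (n i j : nat) : bool :=
  [&& (i < 2 * n)%N, (j < 2 * n)%N &
      [|| (i == 0%N) && (j == 0%N), i.+1 == j | (i == (2 * n).-1) && ~~ odd j]].

Fixpoint walks (n k i j : nat) : int :=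
  if k is k'.+1 then \sum_(l < 2 * n | edge n i l) walks n k' l j
  else (i == j)%:Z.

(** [walks] splits off the first step; the recursions on the end vertex with start 0 fixed need the
    last one. *)
Lemma walksSr n k i j : (i < 2 * n)%N -> (j < 2 * n)%N ->
  walks n k.+1 i j = \sum_(l < 2 * n | edge n l j) walks n k i l.
Proof.
elim: k i => [|k IH] i iN jN.
  rewrite /= big_mkcond [RHS]big_mkcond /=.
  rewrite (bigD1 (Ordinal jN)) //= big1 ?addr0; last first.
    move=> l lj; case: ifP => // _; case: eqP => // e.
    by rewrite -val_eqE /= e eqxx in lj.
  rewrite [RHS](bigD1 (Ordinal iN)) //= big1 ?addr0; last first.
    move=> l lj; case: ifP => // _; case: eqP => // e.
    by rewrite -val_eqE /= -e eqxx in lj.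
  by rewrite !eqxx.
rewrite [LHS](_ : _ = \sum_(l < 2 * n | edge n i l) walks n k.+1 l j) //.
rewrite (eq_bigr (fun l : 'I__ => \sum_(m < 2 * n | edge n m j) walks n k l m));
  last by move=> l _; exact: IH.
by rewrite exchange_big.
Qed.

Lemma card_walks n k (i j : 'I_(2 * n)) :
  #|[pred p : k.-tuple 'I_(2 * n) |
      path (relpre val (edge n)) i p && (last i p == j)]|%:Z = walks n k i j.
Proof.
elim: k i => [|k IH] i.
  rewrite /= -sum1_card.
  rewrite (eq_bigl (fun p => (p == [tuple]) && (i == j))); last first.
    by move=> p; rewrite (tuple0 p) inE /=.
  have [->|ne] := eqVneq i j.
    by rewrite (eq_bigl (pred1 [tuple])) ?big_pred1_eq ?eqxx // => p; rewrite /= andbT.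
  rewrite big_pred0; last by move=> p; rewrite andbF.
  by rewrite val_eqE (negbTE ne).
rewrite /= -(eq_bigr _ (fun l _ => IH l)) -sum1_card (big_morph Posz PoszD (erefl _)).
rewrite (reindex (fun x : 'I_(2 * n) * k.-tuple 'I_(2 * n) => [tuple of x.1 :: x.2])) /=;
  last first.
  exists (fun p => (thead p, [tuple of behead p])) => [[x p] _|p _].
    by congr pair; apply: val_inj.
  by rewrite /= -tuple_eta.
rewrite [RHS](eq_bigr (fun l : 'I_(2 * n) => \sum_(p : k.-tuple 'I_(2 * n) |
   path (relpre val (edge n)) l p && (last l p == j)) 1)); last first.
  by move=> l _; rewrite -sum1_card (big_morph Posz PoszD (erefl _)).
by rewrite pair_big_dep; apply: eq_bigl => -[x p]; rewrite !inE /= andbA.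
Qed.

(** * The trace of the powers of the transition matrix *)

Lemma sum_half (F : nat -> int) n : \sum_(i < 2 * n) F i./2 = \sum_(m < n) 2 * F m.
Proof.
elim: n => [|n IH]; first by rewrite !big_ord0.
rewrite [in RHS]big_ord_recr /= -IH (_ : 2 * n.+1 = (2 * n).+2)%N; last by lia.
rewrite 2!big_ord_recr /= (_ : (2 * n)./2 = n) 1?(_ : uphalf (2 * n) = n); try lia.
ring.
Qed.

(* Each [f s] with [s] even is counted [2 n + 2 - s] times by the double sum on
   the left, and each [f s] with [s] odd one time less. *)
Lemma sum_alternating_prefixes (f : nat -> int) n :
  \sum_(m < n.+1) 2 * (\sum_(s < m.*2.+1) (-1) ^+ s * f s)
    - \sum_(j < n) f j.*2.+1
  = \sum_(s < n.*2.+1) (-1) ^+ s * (n.*2.+2%:Z - s%:Z) * f s.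
Proof.
elim: n => [|n IH]; first by rewrite big_ord0 !big_ord1 /= expr0 !mul1r !subr0.
pose G m := \sum_(s < m.*2.+1) (-1) ^+ s * f s.
have sgn : (-1) ^+ n.*2 = 1 :> int by rewrite -signr_odd odd_double.
have GS : G n.+1 = G n - f n.*2.+1 + f n.*2.+2.
  by rewrite {1}/G doubleS 2!big_ord_recr /= !exprS sgn -/(G n); ring.
have -> : \sum_(s < n.+1.*2.+1) (-1) ^+ s * (n.+1.*2.+2%:Z - s%:Z) * f s
    = \sum_(s < n.*2.+1) (-1) ^+ s * (n.*2.+2%:Z - s%:Z) * f s
      + 2 * G n - 3 * f n.*2.+1 + 2 * f n.*2.+2.
  rewrite doubleS 2!big_ord_recr /= !exprS sgn /G mulr_sumr -big_split /=.
  have -> : n.*2.+4%:Z = n.*2.+2%:Z + 2 by lia.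
  have -> : n.*2.+1%:Z = n.*2.+2%:Z - 1 by lia.
  rewrite (eq_bigr (fun s : 'I_n.*2.+1 => (-1) ^+ s * (n.*2.+2%:Z - s%:Z) * f s
     + 2 * ((-1) ^+ s * f s))); last by move=> s _; ring.
  ring.
rewrite -IH big_ord_recr [\sum_(j < n.+1) f _]big_ord_recr /= -/(G n.+1) GS.
ring.
Qed.

(** With A the transition matrix and d(z) = det(I - zA), Cramer's rule gives z^(2n-1)/d(z) for the
    entry (0, 2n-1) of the inverse of I - zA, since the only simple path from 0 to 2n-1 visits every
    vertex. The shift by 2n-1 leaves 1/d(z). *)
Definition inv_den (n : nat) : fps :=
  fun m => walks n (m + (2 * n).-1) 0 (2 * n).-1.

Section Trace.

Variable n : nat.
Hypothesis n1 : (1 <= n)%N.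

Let bnd : ((2 * n).-1 < 2 * n)%N. Proof. lia. Qed.
Let bnd0 : (0 < 2 * n)%N. Proof. lia. Qed.
Let V m j : int := walks n m 0 j.
Let y m : int := V m (2 * n).-1.

Let VS0 m : V m.+1 0 = V m 0 + y m.
Proof.
rewrite /V walksSr // (bigD1 (Ordinal bnd0)) /= ?/edge; last by lia.
rewrite (bigD1 (Ordinal bnd)) /=; last by rewrite -val_eqE /=; lia.
rewrite big_pred0 ?addr0 // => l; rewrite -!val_eqE /=; lia.
Qed.

Let VS m j : (j.+1 < 2 * n)%N ->
  V m.+1 j.+1 = V m j + (if odd j then y m else 0).
Proof.
move=> jn; have jn' := ltnW jn.
rewrite /V walksSr // (bigD1 (Ordinal jn')) /= ?/edge; last by lia.
congr (_ + _); case: ifP => oj.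
  rewrite (bigD1 (Ordinal bnd)) /=; last by rewrite -val_eqE /=; lia.
  rewrite big_pred0 ?addr0 // => l; rewrite -!val_eqE /=; lia.
by rewrite big_pred0 // => l; rewrite -!val_eqE /=; lia.
Qed.

(** A walk from 0 either stays at 0 or moves to 1, which settles start 1. From a vertex strictly
    between 0 and 2n-1 the step is forced, which moves the start upwards. *)
Let walks_diff m i j : (i.+1 < 2 * n)%N ->
  walks n m i.+1 j = V (m + i.+1)%N j - V (m + i)%N j.
Proof.
elim: i m => [|i IH] m iN.
  rewrite addn1 addn0 {1}/V /= (bigD1 (Ordinal bnd0)) /= ?/edge; last by lia.
  rewrite (bigD1 (Ordinal iN)) /=; last by lia.
  rewrite big_pred0 ?addr0; first by rewrite /V; ring.
  by move=> l; rewrite -!val_eqE /=; lia.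
have := IH m.+1 (ltnW iN); rewrite /= (bigD1 (Ordinal iN)) /= ?/edge; last by lia.
rewrite big_pred0; last by move=> l; rewrite -!val_eqE /=; lia.
by rewrite addr0 => ->; rewrite !addSnnS.
Qed.

(** Along the diagonal the only new contributions come from the top vertex, on arrival at the even
    vertices 2, 4, and so on. *)
Let V_diag m i : (i < 2 * n)%N ->
  V (m + i)%N i = V m 0 + \sum_(j < i./2) y (m + 2 * j + 1)%N.
Proof.
elim: i => [|i IH] iN; first by rewrite addn0 big_ord0 addr0.
rewrite addnS VS // IH ?(ltnW iN) // -addrA; congr (_ + _).
rewrite -[i.+1./2]/(uphalf i) uphalf_half; case: ifP => oi; last by rewrite addr0.
rewrite add1n big_ord_recr /=; congr (_ + y _); lia.
Qed.

(** The sums given by [V_diag] at [k.+1] and [k] interleave into one alternating sum. By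
    [walks_diff] the left side counts closed walks of length [k.+1] at [i] when [i > 0]. *)
Let V_diff k i : (i < 2 * n)%N ->
  V (k.+1 + i)%N i - V (k + i)%N i = \sum_(s < (i./2).*2.+1) (-1) ^+ s * y (k + s)%N.
Proof.
move=> iN; rewrite !V_diag // VS0.
have -> : V k 0 + y k + \sum_(j < i./2) y (k.+1 + 2 * j + 1)%N -
    (V k 0 + \sum_(j < i./2) y (k + 2 * j + 1)%N)
  = y k + (\sum_(j < i./2) y (k.+1 + 2 * j + 1)%N - \sum_(j < i./2) y (k + 2 * j + 1)%N).
  ring.
elim: (i./2) => [|m IH]; first by rewrite !big_ord0 big_ord1 expr0 mul1r addn0; ring.
rewrite doubleS 2!big_ord_recr [in RHS]big_ord_recr big_ord_recr /= -IH.
rewrite !exprS -mul2n exprM sqrrN !expr1n.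
rewrite (_ : k.+1 + 2 * m + 1 = k + (2 * m).+2)%N; last by lia.
rewrite (_ : k + 2 * m + 1 = k + (2 * m).+1)%N; last by lia.
ring.
Qed.

Let y0 m : (m < (2 * n).-1)%N -> y m = 0.
Proof.
have H a i : (a < i)%N -> (i < 2 * n)%N -> V a i = 0.
  elim: a i => [|a IH] [|i] // ai iN; rewrite VS // IH ?(ltnW iN) //.
  by rewrite add0r; case: ifP => // _; rewrite /y IH //; lia.
by move=> h; rewrite /y H.
Qed.

(** [inv_den] is [y] shifted by 2n-1; the terms with [l > k.+1] that the right side adds vanish by
    [y0]. *)
Let conv (p : {poly int}) k : (size p <= (2 * n).+1)%N ->
  fps_mul (fps_poly p) (inv_den n) k.+1
  = \sum_(l < (2 * n).+1) p`_l * y (k + 2 * n - l)%N.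
Proof.
move=> sp; pose M := (k + 2 * n).+2.
pose G l : int :=
  if (l < (2 * n).+1)%N && (l < k.+2)%N then p`_l * y (k + 2 * n - l)%N else 0.
transitivity (\sum_(l < M) G l).
  rewrite /fps_mul (big_ord_widen M (fun l => fps_poly p l * inv_den n (k.+1 - l)%N));
    last by rewrite /M; lia.
  rewrite big_mkcond /=; apply: eq_bigr => l _; rewrite /G andbC.
  case: ltnP => //= lk; rewrite /fps_poly /inv_den; case: ltnP => ln.
    by congr (_ * y _); lia.
  by rewrite nth_default ?mul0r // (leq_trans sp).
rewrite (big_ord_widen M (fun l => p`_l * y (k + 2 * n - l)%N)); last by rewrite /M; lia.
rewrite [RHS]big_mkcond /=; apply: eq_bigr => l _; rewrite /G.
case: ltnP => //= ln; case: ltnP => // lk.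
by rewrite y0 ?mulr0 //; lia.
Qed.

Let y1 : y (2 * n).-1 = 1.
Proof.
have := @V_diag 0 _ bnd; rewrite add0n -/(y _) => ->.
rewrite /V /= big1 ?addr0 // => j _; apply: y0.
by have := ltn_ord j; lia.
Qed.

Let alt_sum k : (1 <= k)%N ->
  y (k + (2 * n).-1)%N - y (k + (2 * n).-1).-1
  = \sum_(s < (2 * n).-1) (-1) ^+ s * y (k + s).-1.
Proof.
case: k => // k _; have := @V_diff k _ bnd.
rewrite /= -!/(y _) addSn /= => ->.
by rewrite (_ : ((2 * n).-1)./2.*2.+1 = (2 * n).-1) //; lia.
Qed.

Let rev_sum (F : nat -> int) m : \sum_(l < m) F l = \sum_(s < m) F (m - s.+1)%N.
Proof. by rewrite (reindex_inj rev_ord_inj). Qed.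

(** The reversal pairs the coefficient of index [2 n - s] with [y (k + s)], the order in which
    [V_diff] lists them. *)
Let split2 (F : nat -> int) :
  \sum_(l < (2 * n).+1) F l
  = F 0%N + F 1%N + \sum_(s < (2 * n).-1) F (2 * n - s)%N.
Proof.
rewrite (_ : (2 * n).+1 = (2 * n).-1.+2); last by lia.
rewrite 2!big_ord_recl addrA; rewrite (rev_sum (fun s => F s.+2)).
congr (_ + _); apply: eq_bigr => s _.
by rewrite /bump /=; congr F; have := ltn_ord s; lia.
Qed.

Let sgn_sub s : (s <= 2 * n)%N -> (-1) ^+ (2 * n - s) = (-1) ^+ s :> int.
Proof.
by move=> h; rewrite -signr_odd -[in RHS]signr_odd oddB // oddM.
Qed.

(** Coefficient [k.+1] vanishes by [alt_sum], which is [V_diff] at the top vertex. *)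
Lemma den_inv_den : fps_mul (fps_poly (gf_den n)) (inv_den n) =1 fps_poly 1.
Proof.
case=> [|k].
  by rewrite /fps_mul big_ord1 /fps_poly coef_gf_den // coef1 mul1r; exact: y1.
rewrite /fps_poly coef1 /= conv; last first.
  by apply/leq_sizeP => j jn; rewrite coef_gf_den // !ifF //; lia.
rewrite (split2 (fun l => (gf_den n)`_l * y (k + 2 * n - l)%N))
  !coef_gf_den //= mul1r mulN1r subn0.
have := @alt_sum k.+1 isT.
rewrite (_ : k.+1 + (2 * n).-1 = k + 2 * n)%N; last by lia.
rewrite -subn1 => ->; rewrite -big_split /=; apply: big1 => s _.
have sn := ltn_ord s; rewrite coef_gf_den //.
rewrite ifF; last by lia.
rewrite ifF; last by lia.
rewrite ifT; last by lia.
rewrite sgn_sub; last by lia.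
by rewrite (_ : (k + 2 * n - (2 * n - s) = k + s)%N); [ring|lia].
Qed.

Lemma trace_walks k : (1 <= k)%N ->
  \sum_(i < 2 * n) walks n k i i = fps_mul (fps_poly (gf_num n)) (inv_den n) k.
Proof.
case: k => // k _; rewrite conv; last first.
  by apply/leq_sizeP => j jn; rewrite coef_gf_num // !ifF //; lia.
rewrite (split2 (fun l => (gf_num n)`_l * y (k + 2 * n - l)%N))
  !coef_gf_num //= mul0r add0r mul1r.
pose F m := \sum_(s < m.*2.+1) (-1) ^+ s * y (k + s)%N.
(* A vertex [i > 0] contributes [F i./2] by [walks_diff] and [V_diff]; vertex 0 contributes
   [V k 0 + F 0] by [VS0]. *)
transitivity (V k 0 + \sum_(i < 2 * n) F i./2).
  rewrite (bigD1 (Ordinal bnd0)) // [in RHS](bigD1 (Ordinal bnd0)) // addrA.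
  congr (_ + _).
    transitivity (V k.+1 0) => //; rewrite VS0; congr (_ + _).
    by rewrite /F /= big_ord1 expr0 mul1r addn0.
  apply: eq_bigr => -[[|i] iN] // _; transitivity (walks n k.+1 i.+1 i.+1) => //.
  by rewrite walks_diff // (addSnnS k i); exact: (V_diff k iN).
(* [V_diag] at the top vertex expresses [V k 0] as [y (k + (2 * n).-1)] minus the odd-index sum of
   [sum_alternating_prefixes]. *)
have := @V_diag k _ bnd; rewrite -/(y _) sum_half.
have [m e] : exists m, n = m.+1 by exists n.-1; lia.
have -> : ((2 * n).-1)./2 = m by lia.
have := sum_alternating_prefixes (fun s => y (k + s)%N) m; rewrite -/F -e.
rewrite (_ : m.*2.+1 = (2 * n).-1)%N; last by lia.
under [X in _ - X = _]eq_bigr do rewrite -mul2n addnS -addn1.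
move=> P D.
have -> : \sum_(s < (2 * n).-1) (gf_num n)`_(2 * n - s) * y (k + 2 * n - (2 * n - s))%N
    = \sum_(s < (2 * n).-1) (-1) ^+ s * ((2 * n).-1.+1%:Z - s%:Z) * y (k + s)%N.
  apply: eq_bigr => s _; have sn := ltn_ord s; rewrite coef_gf_num //.
  rewrite ifF; last by lia.
  rewrite ifT; last by lia.
  rewrite sgn_sub; last by lia.
  rewrite (_ : k + 2 * n - (2 * n - s) = k + s)%N; last by lia.
  by congr (_ * _ * _); lia.
rewrite -P (_ : k + 2 * n - 1 = k + (2 * n).-1)%N; last by lia.
rewrite D; ring.
Qed.

End Trace.

(** * Coding of periodic points *)

Section Coding.

Variables (R : realType) (n : nat).
Hypothesis n1 : (1 <= n)%N.

Local Notation e := (edge n).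
Local Notation g := (@g_fun R n).

(* The coordinate [u] of a point is its distance to the end of the interval that
   lies on the periodic side; with it, [g_n] maps [lap i u] to [lap i.+1 u] for
   [0 < i < 2 n - 1]. *)
Definition lap (i : nat) (u : R) : R :=
  if odd i then n%:R - (i./2)%:R + u else n%:R + 2 + (i./2)%:R - u.

Definition branch_slope (i j : nat) : R :=
  if i == 0%N then (if j == 0%N then - 2^-1 else 2^-1)
  else if i.+1 == j then 1 else - n%:R^-1.

Definition branch_const (i j : nat) : R :=
  if i == 0%N then (if j == 0%N then 1 else 0)
  else if i.+1 == j then 0 else ((j./2).+1)%:R / n%:R.

(* The inverse branch along an edge: the coordinate in lap [i] of the point that
   [g_n] sends to [lap j v]. *)
Definition branch (i j : nat) (v : R) : R := branch_slope i j * v + branch_const i j.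

Let nR_ge1 : 1 <= n%:R :> R. Proof. by rewrite ler1n. Qed.

(** The equation for the top lap is multiplied by [n] to keep divisions out of the arithmetic. *)
Variant edge_spec (i j : nat) : Prop :=
| EdgeLoop of i = 0%N & j = 0%N & (forall v, branch i j v = 1 - v / 2)
| EdgeDown of i = 0%N & j = 1%N & (forall v, branch i j v = v / 2)
| EdgeNext of (0 < i)%N & j = i.+1 & (j < 2 * n)%N & (forall v, branch i j v = v)
| EdgeTop of i = (2 * n).-1 & ~~ odd j & (j < 2 * n)%N &
    (forall v, n%:R * branch i j v = (j./2)%:R + 1 - v).

Lemma edgeP i j : e i j -> edge_spec i j.
Proof.
move=> /and3P[iN jN].
have [i0|ine0] := eqVneq i 0%N.
  have [j0 _|jne0 h] := eqVneq j 0%N.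
    by apply: EdgeLoop => // v;
      rewrite /branch /branch_slope /branch_const i0 j0 /=; ring.
  have j1 : j = 1%N by lia.
  by apply: EdgeDown => // v; rewrite /branch /branch_slope /branch_const i0 j1 /=; ring.
have [ij _|ij /andP[/eqP it oj]] := eqVneq i.+1 j.
  apply: EdgeNext => //; [lia|move=> v].
  by rewrite /branch /branch_slope /branch_const (negbTE ine0) ij eqxx; ring.
apply: EdgeTop => // v.
rewrite /branch /branch_slope /branch_const (negbTE ine0) (negbTE ij).
by rewrite -natr1; field; rewrite pnatr_eq0; lia.
Qed.

Lemma branch_itv i j v : e i j -> 0 <= v <= 1 -> 0 <= branch i j v <= 1.
Proof.
have nR := nR_ge1; move=> /edgeP[_ _ E|_ _ E|_ _ _ E|it oj jN E] /andP[v0 v1];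
  try (rewrite E; lra).
have h : (j./2)%:R + 1 <= n%:R :> R by rewrite natr1 ler_nat; lia.
have j0 : 0 <= (j./2)%:R :> R by exact: ler0n.
have := E v; set w := branch i j v => Ew.
by apply/andP; split; nra.
Qed.

(** Each lap lies in one affine piece: lap 0 in that of slope -2, the top lap in that of slope n,
    and the others in one of the two pieces of slope -1, according to parity. *)
Lemma g_fun_branch i j v : e i j -> 0 <= v <= 1 ->
  g (lap i (branch i j v)) = lap j v.
Proof.
have nR := nR_ge1; move=> eij v01; have := branch_itv eij v01; move: v01.
case: (edgeP eij) => [-> -> E|-> -> E|i0 -> iN E|it oj jN E] /andP[v0 v1] /andP[w0 w1].
- rewrite E in w0 w1 *; rewrite /lap /= g_fun3 //; lra.
- rewrite E in w0 w1 *; rewrite /lap /= g_fun3 //; lra.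
- rewrite E in w0 w1 *; rewrite /lap /=.
  case oi: (odd i) => /=.
    have h : (i./2)%:R + 2 <= n%:R :> R by rewrite -natrD ler_nat; lia.
    rewrite g_fun2 //; last by have := ler0n R i./2; lra.
    rewrite uphalf_half oi add1n -natr1; ring.
  have h : (1 : R) <= (i./2)%:R by rewrite ler1n; lia.
  rewrite g_fun4 //; last by lra.
  rewrite uphalf_half oi add0n; ring.
- have := E v; move: w0 w1; set w := branch i j v => w0 w1 Ew.
  have oi : odd i by lia.
  have ih : (i./2)%:R + 1 = n%:R :> R by rewrite natr1; congr (_%:R); lia.
  rewrite /lap oi (negbTE oj) g_fun1 //; last by lra.
  have -> : n%:R - (i./2)%:R = 1 :> R by rewrite -ih; ring.
  rewrite mulrDr mulr1 Ew; ring.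
Qed.

(* The end [u = 1] of a lap belongs to the neighbouring lap, except for lap 0,
   which is closed; the good coordinates thus partition the domain. *)
Definition good (i : nat) (u : R) : bool :=
  (0 <= u) && (if i == 0%N then u <= 1 else u < 1).

Lemma goodW i u : good i u -> 0 <= u <= 1.
Proof. by case/andP=> -> /=; case: ifP => // _ /ltW. Qed.

Let nat_floor (x : R) (m : nat) : 0 <= x < m%:R ->
  exists2 j : nat, (j < m)%N & j%:R <= x < j.+1%:R.
Proof.
elim: m => [|m IH] /andP[x0 xm]; first by lra.
have [h|h] := ltP x m%:R.
  by have [|j jm jx] := IH; [rewrite x0|exists j => //; lia].
by exists m; rewrite ?h.
Qed.

Lemma good_branch_exists i u : (i < 2 * n)%N -> good i u ->
  exists j v, [/\ e i j, good j v & u = branch i j v].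
Proof.
have nR := nR_ge1; move=> iN; rewrite /good; have [i0|i0] := eqVneq i 0%N => /andP[u0 u1].
  (* The midpoint 1/2 goes to lap 0, where [v = 1] is good, and not to lap 1, where it is not. *)
  have [h|h] := ltP u 2^-1.
    exists 1%N, (2 * u); split.
    - by rewrite /edge i0; lia.
    - by rewrite /=; lra.
    - by rewrite /branch /branch_slope /branch_const i0 /=; lra.
  exists 0%N, (2 - 2 * u); split.
  - by rewrite /edge i0; lia.
  - by rewrite /=; lra.
  - by rewrite /branch /branch_slope /branch_const i0 /=; lra.
have [it|it] := eqVneq i (2 * n).-1; last first.
  exists i.+1, u; split.
  - by rewrite /edge eqxx; lia.
  - by rewrite /=; lra.
  - by rewrite /branch /branch_slope /branch_const (negbTE i0) eqxx; ring.
have [j jn /andP[j1 j2]] : exists2 j : nat, (j < n)%N & j%:R <= n%:R * u < j.+1%:R.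
  apply: nat_floor; apply/andP; split; first by rewrite mulr_ge0 //; lra.
  by rewrite gtr_pMr //; lra.
have br m v : (m < n)%N -> n%:R * u = m%:R + 1 - v -> u = branch i (2 * m) v.
  move=> mn E; have em : e i (2 * m) by rewrite /edge; lia.
  case: (edgeP em) => [|||_ _ _ Ev]; try lia.
  have := Ev v; rewrite (_ : (2 * m)./2 = m); last by lia.
  by rewrite -E => /mulfI -> //; lra.
rewrite -natr1 in j2.
(* For [n u = j] the image is an integer point. Lap [2 j] would give [v = 1], good only if [j = 0];
   otherwise lap [2 j.-1] gives [v = 0]. *)
have [jz|jnz] := eqVneq (n%:R * u) j%:R.
  have [j0|j0] := eqVneq j 0%N.
    exists 0%N, 1; split.
    - by rewrite /edge; lia.
    - by rewrite /good /=; lra.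
    - by rewrite -[0%N](muln0 2); apply: br => //; rewrite jz j0; ring.
  exists (2 * j.-1)%N, 0; split.
  - by rewrite /edge; lia.
  - by case: ifP => _; lra.
  - apply: br; first by lia.
    by rewrite jz natr1 prednK ?subr0 //; lia.
exists (2 * j)%N, (j%:R + 1 - n%:R * u); split.
- by rewrite /edge; lia.
- have jlt : j%:R < n%:R * u by rewrite lt_neqAle eq_sym jnz.
  by case: ifP => _; lra.
- by apply: br => //; ring.
Qed.

Lemma lap_exists x : dom n x ->
  exists i u, [/\ (i < 2 * n)%N, good i u & x = lap i u].
Proof.
have nR := nR_ge1; rewrite /dom /= in_itv /= natrD natrM => /andP[x1 x2].
have [h|h] := ltP x (n%:R + 1).
  have [j jn /andP[j1 j2]] : exists2 j : nat, (j < n)%N & j%:R <= x - 1 < j.+1%:R.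
    by apply: nat_floor; lra.
  exists (2 * (n - j.+1)).+1%N, (x - 1 - j%:R); rewrite -natr1 in j2; split.
  - by lia.
  - by rewrite /good /=; lra.
  - rewrite /lap /= oddM /= mul2n uphalf_double natrB // -natr1; ring.
have [h'|h'] := leP x (n%:R + 2).
  exists 0%N, (n%:R + 2 - x); split; [by lia | by rewrite /good /=; lra|].
  by rewrite /lap /=; ring.
have [j jn /andP[j1 j2]] : exists2 j : nat,
    (j < n)%N & j%:R <= 2 * n%:R + 1 - x < j.+1%:R.
  by apply: nat_floor; lra.
have jn1 : (j.+1 < n)%N.
  by rewrite -(ltr_nat R) -natr1; lra.
exists (2 * (n - j.+1))%N, (2 * n%:R + 1 - x - j%:R); rewrite -natr1 in j2; split.
- by lia.
- by rewrite /good ifF; [lra|lia].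
- rewrite /lap oddM /= mul2n doubleK natrB // -natr1; ring.
Qed.

(** With good coordinates the odd laps fill [1, n+1), lap 0 fills [n+1, n+2] and the positive even
    laps fill (n+2, 2n+1]; within a family the integer part identifies the lap. *)
Lemma lap_inj i j u v : (i < 2 * n)%N -> (j < 2 * n)%N -> good i u -> good j v ->
  lap i u = lap j v -> i = j /\ u = v.
Proof.
have nR := nR_ge1; move=> iN jN gi gj.
have nat_close (a b : nat) (c d : R) : 0 <= c < 1 -> 0 <= d < 1 ->
    a%:R + c = b%:R + d -> a = b.
  move=> /andP[c0 c1] /andP[d0 d1] E; apply/eqP.
  rewrite eqn_leq -(ltnS a) -(ltnS b) -!(ltr_nat R) -!natr1.
  by apply/andP; split; lra.
have half_eq : odd i = odd j -> i./2 = j./2 -> i = j.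
  by move=> o h; rewrite -(odd_double_half i) o h odd_double_half.
have ih : (i./2)%:R + 1 <= n%:R :> R by rewrite natr1 ler_nat; lia.
have jh : (j./2)%:R + 1 <= n%:R :> R by rewrite natr1 ler_nat; lia.
have i0 := ler0n R i./2; have j0 := ler0n R j./2.
have odd_pos a w : odd a -> good a w -> 0 <= w < 1.
  by case: a => // a _.
have even_pos a w : ~~ odd a -> good a w ->
    a = 0%N \/ ((1 : R) <= (a./2)%:R /\ 0 <= w < 1).
  case: a => [|a] oa ga; first by left.
  by right; split; [rewrite ler1n; lia|].
rewrite /lap; case oi: (odd i); case oj: (odd j) => E.
- have iE : i = j.
    apply: half_eq; first by rewrite oi oj.
    apply: (nat_close _ _ v u); [exact: odd_pos gj|exact: odd_pos gi|lra].
  by split=> //; move: E; rewrite iE => /addrI.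
- have /andP[_ h1] := odd_pos _ _ oi gi; have /andP[_ h2] := goodW gj; lra.
- have /andP[_ h1] := odd_pos _ _ oj gj; have /andP[_ h2] := goodW gi; lra.
- have iE : i = j.
    have [ei|[ei1 ei2]] := even_pos _ _ (negbT oi) gi;
    have [ej|[ej1 ej2]] := even_pos _ _ (negbT oj) gj; first by rewrite ei ej.
    + by exfalso; move: (goodW gi) E; rewrite ei /= => {ei} *; lra.
    + by exfalso; move: (goodW gj) E; rewrite ej /= => {ej} *; lra.
    + apply: half_eq; first by rewrite oi oj.
      by apply: (nat_close _ _ v u) => //; lra.
  by split=> //; move: E; rewrite iE => E; lra.
Qed.

(** The excluded end of a nonzero lap pulls back to an end only through an identity branch
    [i -> i.+1], so an orbit through such ends can only climb. *)
Lemma branch_end i j v : e i j -> 0 <= v <= 1 ->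
  (branch i j v == 0) || (branch i j v == 1) ->
  ((v == 0) || (v == 1)) /\
  (v = 1 -> (0 < j)%N -> [/\ branch i j v = 1, j = i.+1 & (0 < i)%N]).
Proof.
have nR := nR_ge1; move=> /edgeP[_ -> E|_ -> E|i0 -> _ E|it oj jN E] /andP[v0 v1].
- by rewrite E => h; split=> //; apply/orP; left; case/orP: h => /eqP h; apply/eqP; lra.
- rewrite E => h; have -> : v = 0 by case/orP: h => /eqP h; lra.
  by rewrite eqxx; split=> // /eqP; rewrite eq_sym oner_eq0.
- by rewrite E; split.
- have h : (j./2)%:R + 1 <= n%:R :> R by rewrite natr1 ler_nat; lia.
  have j0 : 0 <= (j./2)%:R :> R by exact: ler0n.
  have := E v; set w := branch i j v => Ew /orP[]/eqP w0; rewrite w0 ?mulr0 ?mulr1 in Ew.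
    split; first by apply/orP; right; apply/eqP; lra.
    move=> _ jpos; have : (1 : R) <= (j./2)%:R by rewrite ler1n; lia.
    by move=> ?; lra.
  split; first by apply/orP; left; apply/eqP; lra.
  by move=> ve; lra.
Qed.

Lemma branch_slope_le1 i j : e i j -> `|branch_slope i j| <= 1 /\
  (`|branch_slope i j| = 1 -> (0 < i)%N /\ (j = i.+1 \/ j = 0%N)).
Proof.
have nR := nR_ge1; move=> eij; rewrite /branch_slope; have [i0|i0] := eqVneq i 0%N.
  have -> : `|if j == 0%N then - 2^-1 else 2^-1| = 2^-1 :> R.
    by case: ifP => _; rewrite ?normrN ger0_norm //; lra.
  by split; [lra|move=> ?; exfalso; clear i0; lra].
case: eqVneq => [<-|ne]; first by rewrite normr1; split=> // _; split; [lia|left].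
have ni : n%:R^-1 <= 1 :> R by rewrite invf_le1 //; lra.
have ni0 : 0 <= n%:R^-1 :> R by rewrite invr_ge0; lra.
rewrite normrN ger0_norm //; split=> // /eqP.
rewrite invr_eq1 pnatr_eq1 => /eqP nE.
by move: eij; rewrite /edge nE; split; [lia|right; lia].
Qed.

(** * Composition of inverse branches along a walk *)

Fixpoint path_slope (i : nat) (p : seq nat) : R :=
  if p is j :: p' then branch_slope i j * path_slope j p' else 1.

Fixpoint path_const (i : nat) (p : seq nat) : R :=
  if p is j :: p' then branch_slope i j * path_const j p' + branch_const i j else 0.

Definition pullback i p v : R := path_slope i p * v + path_const i p.

Lemma pullback_nil i v : pullback i [::] v = v.
Proof. by rewrite /pullback /=; ring. Qed.

Lemma pullback_cons i j p v : pullback i (j :: p) v = branch i j (pullback j p v).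
Proof. by rewrite /pullback /branch /=; ring. Qed.

Lemma pullback_cat i p q v :
  pullback i (p ++ q) v = pullback i p (pullback (last i p) q v).
Proof.
by elim: p i => [|j p IH] i; rewrite ?pullback_nil //= !pullback_cons IH.
Qed.

Lemma pullback_itv i p v : path e i p -> 0 <= v <= 1 -> 0 <= pullback i p v <= 1.
Proof.
elim: p i => [|j p IH] i; first by rewrite pullback_nil.
by move=> /= /andP[eij ejp] v01; rewrite pullback_cons; apply: branch_itv (IH _ ejp v01).
Qed.

Lemma iter_g_pullback i p v : path e i p -> 0 <= v <= 1 ->
  iter (size p) g (lap i (pullback i p v)) = lap (last i p) v.
Proof.
elim: p i => [|j p IH] i; first by rewrite pullback_nil.
move=> /= /andP[eij ejp] v01; rewrite -iterS iterSr pullback_cons g_fun_branch ?IH //.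
exact: pullback_itv.
Qed.

Lemma pullback_end i p v : path e i p -> 0 <= v <= 1 ->
  (pullback i p v == 0) || (pullback i p v == 1) ->
  ((v == 0) || (v == 1)) /\
  (v = 1 -> (0 < last i p)%N ->
     [/\ pullback i p v = 1, last i p = (i + size p)%N & (0 < i)%N]).
Proof.
elim: p i => [|j p IH] i.
  by rewrite pullback_nil => _ _ h; split=> // v1 i0; rewrite addn0.
move=> /= /andP[eij ejp] v01; rewrite !pullback_cons => h.
have [h1 h2] := branch_end eij (pullback_itv ejp v01) h.
have [h3 h4] := IH _ ejp v01 h1; split=> // v1 l0.
have [p1 lE j0] := h4 v1 l0; have [b1 jE i0] := h2 p1 j0.
by split=> //; rewrite lE jE addSnnS.
Qed.

(* For [n = 1] the edge [1 -> 0] has slope [-1]; this is why the second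
   alternative on [last i p] is needed. *)
Lemma path_slope_le1 i p : path e i p -> `|path_slope i p| <= 1 /\
  (`|path_slope i p| = 1 ->
     ((0 < i)%N \/ p = [::]) /\ (last i p = (i + size p)%N \/ last i p = 0%N)).
Proof.
elim: p i => [|j p IH] i.
  by move=> _; rewrite /= normr1; split=> // _; split; [right|left; rewrite addn0].
move=> /= /andP[eij ejp]; rewrite normrM.
have [s1 s2] := branch_slope_le1 eij; have [t1 t2] := IH _ ejp.
split; first by rewrite mulr_ile1.
move=> h; have s0 := normr_ge0 (branch_slope i j); have t0 := normr_ge0 (path_slope j p).
have sE : `|branch_slope i j| = 1.
  by apply/eqP; rewrite eq_le s1 /= -h ler_piMr.
have tE : `|path_slope j p| = 1.
  by apply/eqP; rewrite eq_le t1 /= -h ler_piMl.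
have [i0 hj] := s2 sE; have [j0 hl] := t2 tE; split; first by left.
case: hj => jE; first by move: hl; rewrite jE addSnnS.
by case: j0 => [|pE]; [rewrite jE|right; rewrite pE /= jE].
Qed.

(** By [path_slope_le1], slope 1 would force [i = i + size p], or [i = 0] together with [0 < i]. *)
Lemma cycle_slope_lt1 i p : (0 < size p)%N -> path e i p -> last i p = i ->
  path_slope i p < 1.
Proof.
move=> p0 eip lE; have [s1 s2] := path_slope_le1 eip.
rewrite lt_neqAle (le_trans (ler_norm _) s1) andbT; apply/eqP => s.
have [|h1 h2] := s2; first by rewrite s normr1.
rewrite lE in h2; case: h1 => [|pE]; last by rewrite pE in p0.
by lia.
Qed.

Definition fixpt i p : R := path_const i p / (1 - path_slope i p).

Lemma fixptP i p v : (0 < size p)%N -> path e i p -> last i p = i ->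
  pullback i p v = v <-> v = fixpt i p.
Proof.
move=> p0 eip lE; have s := cycle_slope_lt1 p0 eip lE.
have nz : 1 - path_slope i p != 0 by rewrite subr_eq0 gt_eqF.
rewrite /pullback /fixpt; split=> [h|->]; last by field.
by apply: (mulIf nz); rewrite divfK //; lra.
Qed.

(** Evaluating s v + c at 0 and 1 gives c >= 0 and s + c <= 1, which bounds c / (1 - s). *)
Lemma fixpt_itv i p : (0 < size p)%N -> path e i p -> last i p = i ->
  0 <= fixpt i p <= 1.
Proof.
move=> p0 eip lE; have s := cycle_slope_lt1 p0 eip lE.
have s' : 0 < 1 - path_slope i p by lra.
have /andP[a0 _] : 0 <= pullback i p 0 <= 1 by apply: pullback_itv => //; lra.
have /andP[_ b1] : 0 <= pullback i p 1 <= 1 by apply: pullback_itv => //; lra.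
rewrite /pullback in a0 b1; rewrite /fixpt; apply/andP; split.
  by apply: divr_ge0; lra.
by rewrite ler_pdivrMr //; lra.
Qed.

(** After the steps [p1], the coordinate of the orbit point is the pullback of [v] along the
    remaining steps [p2]. *)
Definition all_good i p v := forall p1 p2,
  p = p1 ++ p2 -> good (last i p1) (pullback (last i p1) p2 v).

(* If the periodic orbit met the excluded end [u = 1] of some lap, then all its
   coordinates would be ends, and by [pullback_end] the lap index would
   strictly increase around the cycle. *)
Lemma fixpt_all_good i p : (0 < size p)%N -> path e i p -> last i p = i ->
  all_good i p (fixpt i p).
Proof.
move=> p0 eip lE p1 p2 pE; set u := fixpt i p; set j := last i p1.
have u01 : 0 <= u <= 1 by exact: fixpt_itv.
have uE : pullback i p u = u by apply/fixptP.
move: eip; rewrite pE cat_path => /andP[ei1 ej2].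
have w01 := pullback_itv ej2 u01; set w := pullback j p2 u in w01 *.
have uw : pullback i p1 w = u by rewrite -[RHS]uE pE pullback_cat.
have lj : last j p2 = i by rewrite -[RHS]lE pE last_cat.
case/andP: (w01) => w0 w1; rewrite /good w0 /=; case: eqP => // /eqP jn0.
rewrite lt_neqAle w1 andbT; apply/eqP => wE.
have [] := pullback_end ej2 u01; first by rewrite -/w wE eqxx orbT.
move=> uend h2; have [] := pullback_end ei1 w01; first by rewrite uw.
move=> _ h1; have [] := h1 wE; first by rewrite lt0n.
rewrite uw => u1 jE i0; have [] := h2 u1; first by rewrite lj.
rewrite lj => _ iE _; rewrite -/j in jE; move: p0; rewrite pE size_cat; lia.
Qed.

Lemma path_last_lt i p : (i < 2 * n)%N -> path e i p -> (last i p < 2 * n)%N.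
Proof.
by elim: p i => //= j p IH i iN /andP[/and3P[_ jN _] ejp]; apply: IH.
Qed.

(** Applying g removes one step from both walks; the common image has good coordinates in both next
    laps, so these agree by [lap_inj]. *)
Lemma itinerary_inj i p q v w : size p = size q -> path e i p -> path e i q ->
  0 <= v <= 1 -> 0 <= w <= 1 -> all_good i p v -> all_good i q w ->
  lap i (pullback i p v) = lap i (pullback i q w) -> p = q.
Proof.
elim: p q i => [|j p IH] [|k q] //= i [sE] /andP[eij ejp] /andP[eik ekq] v01 w01 gp gq E.
have /(congr1 g) := E; rewrite !pullback_cons !g_fun_branch ?pullback_itv // => E'.
have /and3P[_ jN _] := eij; have /and3P[_ kN _] := eik.
have [jk _] := lap_inj jN kN (gp [:: j] p erefl) (gq [:: k] q erefl) E'.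
move: ekq gq E'; rewrite -jk => ekq gq E'; congr cons.
apply: (IH q j) => // p1 p2 E1.
  by have := gp (j :: p1) p2; rewrite /= E1; apply.
by have := gq (j :: p1) p2; rewrite /= E1; apply.
Qed.

Lemma good_path_exists k i u : (i < 2 * n)%N -> good i u ->
  exists p v, [/\ size p = k, path e i p, good (last i p) v & u = pullback i p v].
Proof.
elim: k i u => [|k IH] i u iN gi; first by exists [::], u; rewrite pullback_nil.
have [j [v [eij gj ->]]] := good_branch_exists iN gi.
have /and3P[_ jN _] := eij; have [p [w [sp ep gw vE]]] := IH _ _ jN gj.
by exists (j :: p), w; rewrite /= sp eij ep pullback_cons -vE.
Qed.

(** * The bijection between closed walks and fixed points *)

Definition cycle_point k (x : 'I_(2 * n) * k.-tuple 'I_(2 * n)) : R :=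
  lap x.1 (fixpt x.1 (map val x.2)).

Definition closed_walks k : {set 'I_(2 * n) * k.-tuple 'I_(2 * n)} :=
  [set x : 'I_(2 * n) * k.-tuple 'I_(2 * n) |
     path (relpre val e) x.1 x.2 && (last x.1 x.2 == x.1)]%SET.

Lemma closed_walksP k x : (1 <= k)%N -> x \in closed_walks k ->
  [/\ (0 < size (map val x.2))%N, path e x.1 (map val x.2)
    & last (val x.1) (map val x.2) = x.1].
Proof.
move=> k1; rewrite inE => /andP[ep /eqP l].
by rewrite size_map size_tuple path_map last_map l.
Qed.

Lemma cycle_point_inj k : (1 <= k)%N -> {in closed_walks k &, injective (@cycle_point k)}.
Proof.
move=> k1 [i p] [j q] xC yC E.
have [/= p0 ep lp] := closed_walksP k1 xC; have [/= q0 eq lq] := closed_walksP k1 yC.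
have gp := fixpt_all_good p0 ep lp; have gq := fixpt_all_good q0 eq lq.
have fp : pullback i (map val p) (fixpt i (map val p)) = fixpt i (map val p).
  by apply/fixptP.
have fq : pullback j (map val q) (fixpt j (map val q)) = fixpt j (map val q).
  by apply/fixptP.
have gi := gp [::] _ erefl; have gj := gq [::] _ erefl.
rewrite /= fp in gi; rewrite /= fq in gj.
have [/val_inj ij _] := lap_inj (ltn_ord i) (ltn_ord j) gi gj E.
rewrite -ij in q0 eq lq gq fq E *; congr pair; apply/val_inj/(inj_map val_inj).
apply: (itinerary_inj _ ep eq (fixpt_itv p0 ep lp) (fixpt_itv q0 eq lq) gp gq).
  by rewrite !size_map !size_tuple.
by rewrite fp fq.
Qed.

Lemma lap_dom i u : (i < 2 * n)%N -> 0 <= u <= 1 -> dom n (lap i u).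
Proof.
move=> iN /andP[u0 u1]; rewrite /dom /= in_itv /= natrD natrM /lap.
have h : (i./2)%:R + 1 <= n%:R :> R by rewrite natr1 ler_nat; lia.
have h0 := ler0n R i./2; case: ifP => _; lra.
Qed.

Lemma ord_seq_exists N (p : seq nat) : all (fun a => a < N)%N p ->
  exists q : seq 'I_N, map val q = p.
Proof.
elim: p => [|a p IH]; first by exists [::].
by move=> /= /andP[aN /IH[q <-]]; exists (Ordinal aN :: q).
Qed.

Lemma fixed_pointsE k : (1 <= k)%N ->
  fixed_points n k g = [set` [fset cycle_point x | x in closed_walks k]%fset].
Proof.
move=> k1; apply/seteqP; split=> x /=.
  move=> [/lap_exists[i [u [iN gi ->]]] fx].
  (* Following the itinerary for k steps gives a second good coordinate of the same point;
     uniqueness closes the walk and makes [u] a fixed point of its pullback. *)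
  have [p [v [sp ep gv uE]]] := good_path_exists k iN gi.
  have := iter_g_pullback ep (goodW gv); rewrite sp -uE fx => E.
  have [iE uv] := lap_inj iN (path_last_lt iN ep) gi gv E.
  have p0 : (0 < size p)%N by rewrite sp.
  have pN : all (fun a => a < 2 * n)%N p.
    elim: p i {iN gi fx uE E iE p0 sp gv uv} ep => //= j p IH i /andP[/and3P[_ jN _] ejp].
    by rewrite jN (IH j).
  have [q qE] := ord_seq_exists pN.
  have sq : size q == k by rewrite -(size_map val) qE sp.
  apply/imfsetP; exists (Ordinal iN, Tuple sq) => /=.
    have ep' : path (relpre val e) (Ordinal iN) q by rewrite -path_map /= qE.
    have lq : last (Ordinal iN) q = Ordinal iN.
      by apply: val_inj; rewrite -last_map /= qE -iE.
    by rewrite inE /= ep' lq eqxx.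
  rewrite /cycle_point /= qE; congr (lap i _); apply/fixptP => //.
  by rewrite {2}uE -uv.
move=> /imfsetP[[i p] /= xC ->]; have [/= p0 ep lp] := closed_walksP k1 xC.
have f01 := fixpt_itv p0 ep lp.
split; first exact: lap_dom.
have := iter_g_pullback ep f01.
by rewrite size_map size_tuple lp (fixptP _ p0 ep lp).2.
Qed.

Lemma fixed_points_count k : (1 <= k)%N ->
  finite_set (fixed_points n k g) /\
  (#|` fset_set (fixed_points n k g)|%fset)%:Z = \sum_(i < 2 * n) walks n k i i.
Proof.
move=> k1; rewrite fixed_pointsE //; split; first exact: finite_fset.
rewrite set_fsetK card_in_imfset; last exact: cycle_point_inj.
rewrite -(eq_bigr _ (fun i _ => card_walks k i i)).
under [RHS]eq_bigr do rewrite -sum1_card (big_morph Posz PoszD (erefl _)).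
rewrite pair_big_dep /= -(big_morph Posz PoszD (erefl _)) sum1_card.
congr Posz; rewrite -cardE; apply: eq_card => x.
by rewrite !inE [RHS]unfold_in.
Qed.

End Coding.

(** * Points of exact period *)

Lemma prod_primes_dvd (s : seq nat) (m : nat) : uniq s -> all prime s ->
  (\prod_(p <- s) p %| m)%N = all (fun p => p %| m)%N s.
Proof.
elim: s => [|p s IH] /=; first by rewrite big_nil dvd1n.
move=> /andP[ps us] /andP[pp aps]; rewrite big_cons Gauss_dvd ?IH //.
rewrite prime_coprime // Euclid_dvd_prod //; apply/negP.
rewrite big_has => /hasP[q qs pq]; move: ps; rewrite (_ : p = q) ?qs //.
by apply/eqP; rewrite -dvdn_prime2 //; exact: (allP aps).
Qed.

Section ExactPeriod.

Variables (T : finType) (f : T -> T) (k : nat).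
Hypothesis k_gt0 : (0 < k)%N.
Hypothesis fk : forall x, iter k f x = x.

Let f_inj : injective f.
Proof.
move=> x y e; rewrite -(fk x) -(fk y) -(prednK k_gt0) !iterSr e //.
Qed.

Let iter_fix d x : (iter d f x == x) = (order f x %| d)%N.
Proof.
have E q : iter (q * order f x) f x = x.
  by elim: q => // q IH; rewrite mulSn addnC iterD iter_order // IH.
rewrite {1}(divn_eq d (order f x)) addnC iterD E /dvdn.
have lt := ltn_pmod d (order_gt0 f x).
apply/eqP/eqP => [e|->] //.
by rewrite -(findex_iter lt) e findex0.
Qed.

Let ord_dvd x : (order f x %| k)%N.
Proof. by rewrite -iter_fix fk. Qed.

(** Each [x] is weighted by the product of 1 - [p divides k / order x] over the primes p of k, which
    is 1 if the order is k and 0 otherwise. Expanded over sets of primes, it gives the signed sum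
    [Phi1]. *)
Lemma Phi1_exact_period (phi : nat -> int) :
  (forall d, (d %| k)%N -> phi d = #|[pred x | iter d f x == x]|%:Z) ->
  Phi1 k phi = #|order_set f k|%:Z.
Proof.
move=> Hphi; rewrite /Phi1; pose P (i : 'I_(size (primes k))) := nth 1%N (primes k) i.
have Pprime i : prime (P i).
  by have := mem_nth 1%N (ltn_ord i); rewrite mem_primes => /andP[].
have Pdvd i : (P i %| k)%N.
  by have := mem_nth 1%N (ltn_ord i); rewrite mem_primes => /and3P[].
have Pinj : injective P.
  by move=> i j /eqP; rewrite nth_uniq ?primes_uniq // => /eqP/val_inj.
have prodE (S : {set 'I_(size (primes k))}) m :
    (\prod_(i in S) P i %| m)%N = [forall (i | i \in S), (P i %| m)%N].
  have -> : (\prod_(i in S) P i = \prod_(p <- [seq P i | i <- enum S]) p)%N.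
    by rewrite big_map big_enum.
  rewrite prod_primes_dvd ?map_inj_uniq ?enum_uniq //; last first.
    by apply/allP => _ /mapP[i _ ->].
  rewrite all_map; apply/allP/forall_inP => H i iS; apply: H.
    by rewrite mem_enum.
  by rewrite mem_enum in iS.
pose F x (i : 'I_(size (primes k))) := (P i %| k %/ order f x)%N.
have termE (S : {set 'I_(size (primes k))}) x :
    (iter (k %/ \prod_(i in S) P i) f x == x) = [forall (i | i \in S), F x i].
  have pk : (\prod_(i in S) P i %| k)%N.
    by rewrite prodE; apply/forall_inP.
  rewrite iter_fix /F -prodE dvdn_divRL // dvdn_divRL ?ord_dvd // mulnC //.
transitivity (\sum_(x : T) \prod_(i < size (primes k)) (1 - (F x i)%:Z)).
  transitivity (\sum_(S : {set 'I_(size (primes k))}) \sum_(x : T)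
     \prod_i (if i \in S then - (F x i)%:Z else 1)).
    apply: eq_bigr => S _; rewrite Hphi; last first.
      by apply: dvdn_div; rewrite prodE; apply/forall_inP.
    rewrite -[X in Posz X]sum1_card (big_morph Posz PoszD (erefl _)) big_mkcond mulr_sumr.
    apply: eq_bigr => x _.
    rewrite -big_mkcond /= prodrN -[#|S|]/#|S|; congr (_ * _).
    rewrite inE termE; case: ifP => [/forall_inP H|/forall_inPn[i iS /negbTE H]].
      by rewrite big1 // => i /H ->.
    by rewrite (bigD1 i) //= H mul0r.
  rewrite exchange_big; apply: eq_bigr => x _.
  rewrite (eq_bigr (fun i => - (F x i)%:Z + 1)); last by move=> i _; rewrite addrC.
  by rewrite bigA_distr; apply: eq_bigr => S _; apply: eq_bigr => i _.
rewrite -sum1_card (big_morph Posz PoszD (erefl _)) [RHS]big_mkcond.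
apply: eq_bigr => x _.
rewrite inE; have [e|ne] := eqVneq (order f x) k.
  rewrite big1 // => i _; rewrite /F e divnn k_gt0.
  by rewrite dvdn1 (gtn_eqF (prime_gt1 (Pprime i))).
(* A prime factor of this quotient divides k, so its factor annihilates the product. *)
have q1 : (1 < k %/ order f x)%N.
  have := ord_dvd x; move=> /dvdnP[q e]; rewrite e mulnK ?order_gt0 //.
  by move: k_gt0 ne; rewrite e; case: q {e} => [|[|]] //; rewrite mul1n eqxx.
have := pdiv_prime q1; set p := pdiv _ => pp.
have pq : (p %| k %/ order f x)%N by exact: pdiv_dvd.
have pk : p \in primes k.
  by rewrite mem_primes pp k_gt0 /=; apply: dvdn_trans pq (dvdn_div (ord_dvd x)).
have pi : (index p (primes k) < size (primes k))%N by rewrite index_mem.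
by rewrite (bigD1 (Ordinal pi)) //= /F /P /= nth_index // pq subrr mul0r.
Qed.

(** The points of order k form a union of orbits, each with k elements. *)
Lemma dvd_exact_period : (k %| #|order_set f k|)%N.
Proof.
have cl : fclosed f (order_set f k).
  apply: (intro_closed (fconnect_sym f_inj)) => x y /eqP <-.
  rewrite !inE (_ : order f (f x) = order f x) //.
  by apply: (eq_order_cycle (cycle_orbit f_inj x));
    rewrite -fconnect_orbit ?fconnect1 ?connect0.
by rewrite -(fcard_order_set f_inj (subxx _) cl) dvdn_mull.
Qed.

End ExactPeriod.

(** * Transfer to an arbitrary [g], and the theorem *)

Lemma eq_fixed_points (R : realType) n (g h : R -> R) k : (1 <= n)%N ->
  is_g n g -> is_g n h -> fixed_points n k g = fixed_points n k h.
Proof.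
move=> n1 Hg Hh.
have H m x : dom n x -> dom n (iter m h x) /\ iter m g x = iter m h x.
  move=> dx; elim: m => [|m [IH1 IH2]] //=; split; first exact: (g_stable Hh).
  by rewrite IH2; apply: (is_g_unique n1 Hg Hh); rewrite inE.
by apply/seteqP; split=> x [dx fx]; split=> //; have [_ e] := H k x dx;
  rewrite ?e // -e.
Qed.

(** [g] acts on the finite set [A] of fixed points of its k-th iterate, and there the k-th iterate
    is the identity. For [d] dividing [k], every fixed point of the d-th iterate lies in [A]. *)
Lemma dvd_Phi1_fixed_points (R : realType) n (g : R -> R) k (phi : nat -> int) :
  (1 <= k)%N -> (forall x, dom n x -> dom n (g x)) ->
  (forall d, (1 <= d)%N -> finite_set (fixed_points n d g) /\
     (#|` fset_set (fixed_points n d g)|%fset)%:Z = phi d) ->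
  (k%:Z %| Phi1 k phi)%Z.
Proof.
move=> k1 gdom Hphi; have [finA _] := Hphi k k1.
pose A := fset_set (fixed_points n k g).
have AP x : reflect (dom n x /\ iter k g x = x) (x \in A).
  by rewrite in_fset_set //; apply: (iffP idP); rewrite inE.
have Ag x : x \in A -> g x \in A.
  by move=> /AP[dx fx]; apply/AP; split; [exact: gdom|rewrite -iterSr /= fx].
pose f (x : A) : A := [` Ag _ (valP x)]%fset.
have valf d x : val (iter d f x) = iter d g (val x) by elim: d => //= d ->.
have fk x : iter k f x = x.
  by apply: val_inj; rewrite valf; have /AP[] := valP x.
rewrite (@Phi1_exact_period _ f k) //; first exact: dvd_exact_period.
move=> d dk; have d1 : (1 <= d)%N by exact: dvdn_gt0 dk.
have [find <-] := Hphi d d1; congr Posz.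
have -> : fset_set (fixed_points n d g)
    = [fset val x | x in [pred x : A | iter d f x == x]]%fset.
  apply/fsetP => x; rewrite in_fset_set //; apply/idP/imfsetP => /=.
    rewrite inE => -[dx fx]; have xA : x \in A.
      apply/AP; split=> //; have /dvdnP[q ->] := dk.
      by elim: q => // q IH; rewrite mulSn iterD IH.
    exists [` xA]%fset => //; apply/eqP/val_inj; rewrite valf.
    exact: fx.
  move=> [y /eqP /(congr1 val)]; rewrite valf => fy ->; rewrite inE.
  by split=> //; have /AP[] := valP y.
by rewrite card_imfset /= -?cardE //; exact: val_inj.
Qed.

Theorem theorem3 (R : realType) (n : nat) (n_ge1 : (1 <= n)%N)
    (b : nat -> int) (b_spec : is_b n b) :
  [/\ forall g : R -> R, is_g n g ->
        forall k : nat, (1 <= k)%N ->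
          finite_set (fixed_points n k g) /\
          (#|` fset_set (fixed_points n k g)|%fset)%:Z = b k,
      forall k : nat, (1 <= k)%N -> (Phi1 k b = 0 %[mod k%:Z])%Z
    & fps_is_quotient (gen_fun b) (fps_poly (gf_num n)) (fps_poly (gf_den n))].
Proof.
have den_h := den_inv_den n_ge1.
(* Equality holds for positive indices only, as [b 0] is arbitrary; at index 0 [gen_fun] takes the
   value 0, the constant term of the numerator. *)
have bE := is_b_unique n_ge1 b_spec (gf_quotient_is_b n_ge1 den_h).
have gP := @is_g_exists R n n_ge1.
have count k : (1 <= k)%N -> finite_set (fixed_points n k (@g_fun R n)) /\
    (#|` fset_set (fixed_points n k (@g_fun R n))|%fset)%:Z = b k.
  by move=> k1; rewrite bE // -trace_walks //; exact: fixed_points_count.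
split.
- by move=> g Hg k k1; rewrite (eq_fixed_points k n_ge1 Hg gP); exact: count.
- move=> k k1; rewrite mod0z; apply/dvdz_mod0P.
  exact: (dvd_Phi1_fixed_points k1 (g_stable gP) count).
- exists (inv_den n) => // -[|k]; last by rewrite /= bE.
  by rewrite /fps_mul big_ord1 /fps_poly coef_gf_num // mul0r.
Qed.
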